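(* Let $a,b,c\in\mathbb{C}$ be such that $E=\mathbb{V}\big((a^3+b^3+c^3)XYZ-abc(X^3+Y^3+Z^3)\big)\subset\mathbb{P}^2$ is a smooth elliptic curve, let $p=[a:b:c]\in E$, and let $A$ be the 3-dimensional Sklyanin algebra corresponding to the pair $(E,p)$, with its canonical central element of degree 3 $$c_3=c(a^3-c^3)x^3+a(b^3-c^3)xyz+b(c^3-a^3)yxz+c(c^3-b^3)y^3 .$$ Put $$\Psi=a(b^3-c^3)(xyz+yzx+zxy)+b(c^3-a^3)(yxz+xzy+zyx)+c(a^3-b^3)(x^3+y^3+z^3)\in\mathbb{C}\langle x,y,z\rangle .$$ Then $3c_3$ equals the image of $\Psi$ in $A$. Moreover, $\Psi$ is the superpotential (up to a nonzero scalar) of the 3-dimensional Sklyanin algebra $A'$ corresponding to the pair $(E,[-2]p)$.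
   Context: Work over $\mathbb{C}$. For a smooth elliptic curve $E\subset\mathbb{P}^2$ in Hesse normal form, the group law on $E$ is the one with origin the flex point $[1:-1:0]$, and $[m]$ denotes multiplication by $m$. For a point $q=[\alpha:\beta:\gamma]$ on $E$, the 3-dimensional Sklyanin algebra corresponding to the pair $(E,q)$ is the quotient of the free algebra $\mathbb{C}\langle x,y,z\rangle$ by the two-sided ideal generated by $$\alpha xy+\beta yx+\gamma z^2,\qquad \alpha yz+\beta zy+\gamma x^2,\qquad \alpha zx+\beta xz+\gamma y^2 .$$ In particular $A$ is this algebra for $q=p=[a:b:c]$. The cyclic derivative $\partial_v$ with respect to a variable $v\in\{x,y,z\}$ is the linear map sending a word $w$ to $\sum_{w=w_1vw_2}w_2w_1$. An element $W$ of $\mathbb{C}\langle x,y,z\rangle$ is a superpotential for an algebra if that algebra is $\mathbb{C}\langle x,y,z\rangle/(\partial_xW,\partial_yW,\partial_zW)$. For example $W=\alpha xyz+\beta yxz+\frac{\gamma}{3}(x^3+y^3+z^3)$, or equivalently (up to the factor 3) its cyclically symmetrized form $\alpha(xyz+yzx+zxy)+\beta(yxz+xzy+zyx)+\gamma(x^3+y^3+z^3)$, is the superpotential of the Sklyanin algebra with parameters $[\alpha:\beta:\gamma]$. *)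

(* Defs.v *)
From HB Require Import structures.
From mathcomp Require Import all_boot all_order all_algebra.
From mathcomp Require Import generic_quotient ring_quotient.
From mathcomp Require Import boolp classical_sets reals.
From mathcomp Require Export complex.
From mathcomp Require finmap mpoly monalg.

Set Implicit Arguments.
Unset Strict Implicit.
Unset Printing Implicit Defensive.

Import GRing.Theory.
Local Open Scope ring_scope.
Local Open Scope quotient_scope.
Local Open Scope classical_set_scope.

Definition triple (K : fieldType) (a b c : K) : 'rV[K]_3 :=
  \row_i [tuple a; b; c]`_i.

Module PlaneCurves.
Import mpoly.

(* A point of the projective plane over K is a one-dimensional subspace of
   K^3; curves are given by their (homogeneous) equations. *)
Definition ppoint (K : fieldType) (a b c : K) : {vspace 'rV[K]_3} :=
  <[triple a b c]>%VS.

Definition on_curve (K : fieldType) (F : {mpoly K[3]})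
    (P : {vspace 'rV[K]_3}) : Prop :=
  \dim P = 1%N /\ forall v, v \in P -> F.@[v 0] = 0.

Definition smooth (K : fieldType) (F : {mpoly K[3]}) : Prop :=
  forall v : 'rV[K]_3, v != 0 -> F.@[v 0] = 0 ->
    exists i : 'I_3, (mderiv i F).@[v 0] != 0.

Definition hesse_cubic (K : fieldType) (a b c : K) : {mpoly K[3]} :=
  (a ^+ 3 + b ^+ 3 + c ^+ 3) *: ('X_0 * 'X_1 * 'X_2)
  - (a * b * c) *: ('X_0 ^+ 3 + 'X_1 ^+ 3 + 'X_2 ^+ 3).

(* The line spanned by u and v cuts the cubic F = 0 in the divisor P + Q + T,
   multiplicities included: the binary cubic form F(x u + y v) is the product
   of linear forms vanishing at P, Q and T.  The nonzero constant in front of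
   the product is absorbed in the choice of the coordinates (s i, t i). *)
Definition line_section (K : fieldType) (F : {mpoly K[3]})
    (P Q T : {vspace 'rV[K]_3}) : Prop :=
  exists (u v : 'rV[K]_3) (s t : 'I_3 -> K),
    let pt i := <[s i *: u + t i *: v]>%VS in
    [/\ free [:: u; v],
        forall i, (s i != 0) || (t i != 0),
        [/\ P = pt 0, Q = pt 1 & T = pt 2]
      & forall x y : K,
          F.@[(x *: u + y *: v) 0] = \prod_i (t i * x - s i * y)].

(* Chord-tangent group law with origin O; on a smooth cubic the third
   intersection point exists and is unique. *)
Definition third (K : fieldType) (F : {mpoly K[3]})
    (P Q : {vspace 'rV[K]_3}) : {vspace 'rV[K]_3} :=
  xget 0%VS [set T | line_section F P Q T].

Definition ecadd (K : fieldType) (F : {mpoly K[3]})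
    (O P Q : {vspace 'rV[K]_3}) : {vspace 'rV[K]_3} :=
  third F (third F P Q) O.

Definition ecopp (K : fieldType) (F : {mpoly K[3]})
    (O P : {vspace 'rV[K]_3}) : {vspace 'rV[K]_3} :=
  third F P (third F O O).

Definition ecmul (K : fieldType) (F : {mpoly K[3]})
    (O : {vspace 'rV[K]_3}) (m : int) (P : {vspace 'rV[K]_3}) :
    {vspace 'rV[K]_3} :=
  match m with
  | Posz n => iter n (ecadd F O P) O
  | Negz n => ecopp F O (iter n.+1 (ecadd F O P) O)
  end.

Definition hesse_origin (K : fieldType) : {vspace 'rV[K]_3} :=
  ppoint 1 (-1) 0.

End PlaneCurves.
Export PlaneCurves.

Definition is_ideal (A : pzRingType) (I : set A) : Prop :=
  [/\ I 0, forall x y, I x -> I y -> I (x + y)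
    & forall r s x, I x -> I (r * x * s)].

Definition ideal_gen (A : pzRingType) (S : set A) : set A :=
  smallest (@is_ideal A) S.

Section QuotientAlgebra.
Variables (K : fieldType) (A : algType K) (S : set A).

Definition ideal_pred (x : A) : bool := `[< ideal_gen S x >].

Lemma ideal_gen_ideal : is_ideal (ideal_gen S).
Proof.
split=> [|x y Ix Iy|r s x Ix] I /= HI; case: (HI) => -[I0 ID IM] SI.
- exact: I0.
- exact: (ID _ _ (Ix _ HI) (Iy _ HI)).
- exact: (IM _ _ _ (Ix _ HI)).
Qed.

Lemma ideal_predP x : reflect (ideal_gen S x) (ideal_pred x).
Proof. exact: asboolP. Qed.

Lemma ideal_predM r s x : ideal_pred x -> ideal_pred (r * x * s).
Proof.
case: ideal_gen_ideal => _ _ IM /ideal_predP Ix.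
by apply/ideal_predP; exact: (IM r s x Ix).
Qed.

Lemma ideal_pred_zmod_closed : zmod_closed ideal_pred.
Proof.
case: ideal_gen_ideal => I0 ID IM; split=> [|x y].
  by apply/ideal_predP; exact: I0.
move=> /ideal_predP Ix /ideal_predP Iy; apply/ideal_predP.
apply: (ID _ _ Ix); rewrite -[y]mul1r -mulNr -[_ * y]mulr1.
exact: (IM _ _ _ Iy).
Qed.

HB.instance Definition _ :=
  GRing.isZmodClosed.Build A ideal_pred ideal_pred_zmod_closed.

Definition ideal_zmod : zmodClosed A := GRing.ZmodClosed.clone _ ideal_pred _.

(* A/(S), with its ring and K-module structures.  It may be the zero ring, so it
   is not an algType; quot_scaleAl and quot_scaleAr say that the two structures
   are compatible. *)
Definition quot_alg : Type := {ideal_quot ideal_zmod}.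

HB.instance Definition _ := Choice.on quot_alg.
HB.instance Definition _ := EqQuotient.on quot_alg.
HB.instance Definition _ := GRing.Zmodule.on quot_alg.

Local Notation Q := quot_alg.

Lemma pi_quotP (x y : A) : reflect (\pi_Q x = \pi_Q y) (ideal_pred (x - y)).
Proof.
apply: (iffP idP) => [Ixy|/eqP]; first by apply/eqP; rewrite -Quotient.idealrBE.
by rewrite -Quotient.idealrBE.
Qed.

Lemma quot_piD : {morph \pi_Q : x y / x + y}.
Proof.
by move=> x y; rewrite -[LHS]/(\pi_({ideal_quot ideal_zmod}) _) pi_addr.
Qed.

Definition quot_one : Q := \pi_Q 1.
Definition quot_mul (x y : Q) : Q := \pi_Q (repr x * repr y).
Definition quot_scale (k : K) (x : Q) : Q := \pi_Q (k *: repr x).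

Lemma quot_piM : {morph \pi_Q : x y / x * y >-> quot_mul x y}.
Proof.
move=> x y; apply/pi_quotP.
have /pi_quotP Hx : \pi_Q x = \pi_Q (repr (\pi_Q x)) by rewrite reprK.
have /pi_quotP Hy : \pi_Q y = \pi_Q (repr (\pi_Q y)) by rewrite reprK.
set x' := repr _ in Hx *; set y' := repr _ in Hy *.
have -> : x * y - x' * y' = 1 * (x - x') * y + x' * (y - y') * 1.
  by rewrite mul1r mulr1 mulrBl mulrBr addrA subrK.
exact: (rpredD (ideal_predM 1 y Hx) (ideal_predM x' 1 Hy)).
Qed.

Lemma quot_piZ k : {morph \pi_Q : x / k *: x >-> quot_scale k x}.
Proof.
move=> x; apply/pi_quotP.
have /pi_quotP Hx : \pi_Q x = \pi_Q (repr (\pi_Q x)) by rewrite reprK.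
rewrite -scalerBr -[_ - _]mul1r scalerAl -[_ * _]mulr1.
exact: ideal_predM.
Qed.

Fact quot_mulA : associative quot_mul.
Proof.
elim/quotW=> x; elim/quotW=> y; elim/quotW=> z.
by rewrite -(quot_piM y z) -(quot_piM x y) -(quot_piM x) -(quot_piM _ z) mulrA.
Qed.

Fact quot_mul1 : left_id quot_one quot_mul.
Proof. by elim/quotW=> x; rewrite -(quot_piM 1 x) mul1r. Qed.

Fact quot_mulr1 : right_id quot_one quot_mul.
Proof. by elim/quotW=> x; rewrite -(quot_piM x 1) mulr1. Qed.

Fact quot_mulDl : left_distributive quot_mul +%R.
Proof.
elim/quotW=> x; elim/quotW=> y; elim/quotW=> z.
rewrite -(quot_piD x y) -(quot_piM x z) -(quot_piM y z) -(quot_piM _ z).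
by rewrite -(quot_piD (x * z)) mulrDl.
Qed.

Fact quot_mulDr : right_distributive quot_mul +%R.
Proof.
elim/quotW=> x; elim/quotW=> y; elim/quotW=> z.
rewrite -(quot_piD y z) -(quot_piM x y) -(quot_piM x z) -(quot_piM x).
by rewrite -(quot_piD (x * y)) mulrDr.
Qed.

HB.instance Definition _ := GRing.Zmodule_isPzRing.Build Q
  quot_mulA quot_mul1 quot_mulr1 quot_mulDl quot_mulDr.

Fact quot_scaleA k l x : quot_scale k (quot_scale l x) = quot_scale (k * l) x.
Proof.
elim/quotW: x => x.
by rewrite -(quot_piZ l x) -(quot_piZ k) -(quot_piZ _ x) scalerA.
Qed.

Fact quot_scale1 : left_id 1 quot_scale.
Proof. by elim/quotW=> x; rewrite -(quot_piZ 1 x) scale1r. Qed.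

Fact quot_scaleDr : right_distributive quot_scale +%R.
Proof.
move=> k; elim/quotW=> x; elim/quotW=> y.
rewrite -(quot_piD x y) -(quot_piZ k x) -(quot_piZ k y) -(quot_piZ k).
by rewrite -(quot_piD (k *: x)) scalerDr.
Qed.

Fact quot_scaleDl x : {morph quot_scale^~ x : k l / k + l}.
Proof.
elim/quotW: x => x k l /=.
rewrite -(quot_piZ k x) -(quot_piZ l x) -(quot_piZ _ x).
by rewrite -(quot_piD (k *: x)) scalerDl.
Qed.

HB.instance Definition _ := GRing.Zmodule_isLmodule.Build K Q
  quot_scaleA quot_scale1 quot_scaleDr quot_scaleDl.

Fact quot_scaleAl (k : K) (x y : Q) : k *: (x * y) = k *: x * y.
Proof.
elim/quotW: x => x; elim/quotW: y => y.
rewrite -[LHS]/(quot_scale k (quot_mul _ _)).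
rewrite -[RHS]/(quot_mul (quot_scale k _) _).
rewrite -(quot_piM x y) -(quot_piZ k x) -(quot_piZ k) -(quot_piM _ y).
by rewrite scalerAl.
Qed.

Fact quot_scaleAr (k : K) (x y : Q) : k *: (x * y) = x * (k *: y).
Proof.
elim/quotW: x => x; elim/quotW: y => y.
rewrite -[LHS]/(quot_scale k (quot_mul _ _)).
rewrite -[RHS]/(quot_mul _ (quot_scale k _)).
rewrite -(quot_piM x y) -(quot_piZ k y) -(quot_piZ k) -(quot_piM x).
by rewrite scalerAr.
Qed.

End QuotientAlgebra.

Module FreeAlgebra.
Import finmap monalg.

(* The free algebra K<x,y,z>, i.e. the algebra of the free monoid on 'I_3. *)
Definition free_alg (K : fieldType) : Type := {malg K[{fmonom 'I_3}]}.

Section Instances.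
Variable K : fieldType.

HB.instance Definition _ := GRing.Lalgebra.on (free_alg K).

Fact free_alg_scaleAr (k : K) (f g : free_alg K) : k *: (f * g) = f * (k *: g).
Proof.
have comm (h : {malg K[{fmonom 'I_3}]}) : k%:MP * h = h * k%:MP.
  rewrite !malgM_def fgmulUg fgmulgU; apply/eq_bigr=> m _.
  by rewrite mul1m mulm1 mulrC.
by rewrite -[LHS]mul_malgC -[k *: g]mul_malgC mulrA comm -mulrA.
Qed.

HB.instance Definition _ :=
  GRing.Lalgebra_isAlgebra.Build K (free_alg K) free_alg_scaleAr.

End Instances.

Section Potentials.
Variable K : fieldType.
Local Notation A := (free_alg K).

Definition word (w : seq 'I_3) : A := << FMonom w >>.

Definition gen (i : 'I_3) : A := word [:: i].

Definition cyc_deriv_word (v : 'I_3) (w : seq 'I_3) : A :=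
  \sum_(i < size w | nth ord0 w i == v) word (drop i.+1 w ++ take i w).

Definition cyc_deriv (v : 'I_3) (W : A) : A :=
  \sum_(m <- msupp W) (W : {malg K[{fmonom 'I_3}]})@_m *: cyc_deriv_word v m.

(* W is a superpotential for the algebra K<x,y,z>/(S): both algebras being
   quotients of K<x,y,z>, they coincide when the defining ideals do. *)
Definition superpotential (W : A) (S : set A) : Prop :=
  ideal_gen [set f | exists v, f = cyc_deriv v W] = ideal_gen S.

End Potentials.
End FreeAlgebra.
Export FreeAlgebra.

Section Sklyanin.
Variable K : fieldType.
Local Notation x := (gen K 0).
Local Notation y := (gen K 1).
Local Notation z := (gen K 2).

Definition sklyanin_relations (al be ga : K) : set (free_alg K) :=
  [set f | f \in [:: al *: (x * y) + be *: (y * x) + ga *: z ^+ 2;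
                     al *: (y * z) + be *: (z * y) + ga *: x ^+ 2;
                     al *: (z * x) + be *: (x * z) + ga *: y ^+ 2]].

Definition sklyanin (al be ga : K) : Type :=
  quot_alg (sklyanin_relations al be ga).

HB.instance Definition _ al be ga := Choice.on (sklyanin al be ga).
HB.instance Definition _ al be ga := EqQuotient.on (sklyanin al be ga).
HB.instance Definition _ al be ga := GRing.PzRing.on (sklyanin al be ga).
HB.instance Definition _ al be ga := GRing.Lmodule.on (sklyanin al be ga).

Definition sklyanin_potential (al be ga : K) : free_alg K :=
  al *: (x * y * z + y * z * x + z * x * y)
  + be *: (y * x * z + x * z * y + z * y * x)
  + ga *: (x ^+ 3 + y ^+ 3 + z ^+ 3).

(* A lift to K<x,y,z> of the canonical central element of degree 3. *)
Definition c3 (a b c : K) : free_alg K :=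
  (c * (a ^+ 3 - c ^+ 3)) *: x ^+ 3
  + (a * (b ^+ 3 - c ^+ 3)) *: (x * y * z)
  + (b * (c ^+ 3 - a ^+ 3)) *: (y * x * z)
  + (c * (c ^+ 3 - b ^+ 3)) *: y ^+ 3.

Definition Psi (a b c : K) : free_alg K :=
  (a * (b ^+ 3 - c ^+ 3)) *: (x * y * z + y * z * x + z * x * y)
  + (b * (c ^+ 3 - a ^+ 3)) *: (y * x * z + x * z * y + z * y * x)
  + (c * (a ^+ 3 - b ^+ 3)) *: (x ^+ 3 + y ^+ 3 + z ^+ 3).

End Sklyanin.

(* Main.v *)
Require Import Defs.
From HB Require Import structures.
From mathcomp Require Import all_boot all_order all_algebra ring.
From mathcomp Require Import generic_quotient complex reals.
From mathcomp Require Import classical_sets.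
From mathcomp Require finmap mpoly monalg.

(* With S = a^3 + b^3 + c^3 and M = abc, the curve is smooth only if M and
   S^3 - 27 M^3 are nonzero: (1, 0, 0), resp. (3M, S, S), is otherwise singular.
   The chord through [al : be : ga] and the flex O meets E again in
   [be : al : ga], so O + p = p and [-2]p = third (third (third p p) O) O is
   the third point third p p of the tangent at p.  For
   t = (a(b^3 - c^3), b(c^3 - a^3), c(a^3 - b^3)) the restriction of the cubic
   to the line through p and t is -M (S^3 - 27 M^3) x y^2, so t is this third
   point; its coordinates are the parameters of Psi. *)

Set Implicit Arguments.
Unset Strict Implicit.
Unset Printing Implicit Defensive.

Import GRing.Theory Num.Theory.
Local Open Scope ring_scope.
Local Open Scope quotient_scope.

(** * Lines and independent pairs in a vector space *)

Section Lines.
Variables (K : fieldType) (V : vectType K).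
Implicit Types u v w : V.

Lemma vline_eqP u v : u != 0 -> (<[u]> = <[v]>)%VS -> exists2 k, k != 0 & v = k *: u.
Proof.
move=> u0 E.
have /vlineP[k kE] : v \in <[u]>%VS by rewrite E memv_line.
have /vlineP[l lE] : u \in <[v]>%VS by rewrite -E memv_line.
exists k => //; apply: contraNneq u0 => k0.
by rewrite lE kE k0 scale0r scaler0.
Qed.

Lemma vlineZ k v : k != 0 -> (<[k *: v]> = <[v]>)%VS.
Proof.
move=> k0; apply/eqP; rewrite eqEsubv -!memvE memvZ ?memv_line //=.
by apply/vlineP; exists k^-1; rewrite scalerA mulVf ?scale1r.
Qed.

Lemma free2P u v :
  reflect (forall x y, x *: u + y *: v = 0 -> x = 0 /\ y = 0) (free [:: u; v]).
Proof.
rewrite free_cons span_seq1 seq1_free; apply: (iffP andP) => [[uv v0] x y E|H].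
  have x0 : x = 0.
    apply: contraNeq uv => x0; apply/vlineP; exists (- (x^-1 * y)).
    apply: (scalerI x0); rewrite scalerA mulrN mulVKf // scaleNr.
    by apply/eqP; rewrite -addr_eq0 E.
  by move: E; rewrite x0 scale0r add0r => /eqP; rewrite scaler_eq0 (negPf v0) orbF => /eqP.
split.
  apply/negP => /vlineP[k uE]; have [] := H 1 (- k).
    by rewrite scale1r scaleNr uE subrr.
  by move/eqP; rewrite oner_eq0.
apply/eqP => v0; have [] := H 0 1; first by rewrite v0 scale0r scaler0 addr0.
by move=> _ /eqP; rewrite oner_eq0.
Qed.

End Lines.

Lemma I3P (i : 'I_3) : [\/ i = 0, i = 1 | i = 2].
Proof.
by case: i => [[|[|[|//]]] ?]; [constructor 1|constructor 2|constructor 3]; exact: val_inj.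
Qed.

Lemma I3_prod (R : comPzRingType) (F : 'I_3 -> R) : \prod_i F i = F 0 * F 1 * F 2.
Proof.
rewrite !big_ord_recl big_ord0 mulr1 mulrA; congr (_ * F _ * F _); exact: val_inj.
Qed.

(** The rows [p] and [v] stack to a matrix of rank 2 whose row space lies in the left kernel of [G];
    that kernel also has dimension 3 - 1 = 2, so the two coincide. *)
Lemma kernel_plane (K : fieldType) (p v w : 'rV[K]_3) (G : 'cV[K]_3) :
  free [:: p; v] -> G != 0 -> p *m G = 0 -> v *m G = 0 -> w *m G = 0 ->
  exists al be, w = al *: p + be *: v.
Proof.
move=> /free2P pv G0 pG vG wG.
have split_mul (D : 'rV[K]_(1 + 1)) :
    D *m col_mx p v = lsubmx D 0 0 *: p + rsubmx D 0 0 *: v.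
  rewrite -{1}[D]hsubmxK mul_row_col {1}[lsubmx D]mx11_scalar {1}[rsubmx D]mx11_scalar.
  by rewrite !mul_scalar_mx.
have rM : row_free (col_mx p v).
  apply: inj_row_free => D; rewrite split_mul => /pv[l0 r0].
  rewrite -[D]hsubmxK [lsubmx D]mx11_scalar [rsubmx D]mx11_scalar l0 r0.
  by rewrite !raddf0 row_mx0.
have MG : (col_mx p v <= kermx G)%MS by apply/sub_kermxP; rewrite mul_col_mx pG vG col_mx0.
have := mxrank_leqif_eq MG; rewrite mxrank_ker -[\rank G]mxrank_tr rank_rV trmx_eq0 G0.
rewrite (eqP rM) => /leqifP.
case: ifP => // /andP[_ GM _].
have /submx_trans/(_ GM)/submxP[D ->] : (w <= kermx G)%MS by apply/sub_kermxP.
by exists (lsubmx D 0 0), (rsubmx D 0 0); exact: split_mul.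
Qed.

(** * Third intersection point of a line with a plane cubic *)

Section LineSections.
Import mpoly.
Variables (K : fieldType) (F : {mpoly K[3]}).
Implicit Types (p q u v w : 'rV[K]_3).

(** Provides uniqueness in [third_secant]: in the basis [p], [q] the linear forms vanishing at [p]
    and [q] become multiples of [y] and [x], so only the third factor remains free. *)
Lemma line_section_secant p q T : free [:: p; q] -> line_section F <[p]> <[q]> T ->
  exists A B, (forall x y, F.@[(x *: p + y *: q) 0] = x * y * (A * x + B * y)) /\
    T = <[B *: p - A *: q]>%VS.
Proof.
move=> /free2P pq [u [v [s [t [/free2P uv st [Pp Pq ->] Fuv]]]]].
have p0 : p != 0.
  by apply/eqP => p0; have [|/eqP] := pq 1 0; rewrite ?oner_eq0 // p0 scaler0 scale0r addr0.
have q0 : q != 0.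
  by apply/eqP => q0; have [|_ /eqP] := pq 0 1; rewrite ?oner_eq0 // q0 scaler0 scale0r addr0.
have [k0 k0n pE] : exists2 k, k != 0 & p = k *: (s 0 *: u + t 0 *: v).
  have [k kn E] := vline_eqP p0 Pp; exists k^-1; first by rewrite invr_neq0.
  by rewrite E scalerA mulVf // scale1r.
have [k1 k1n qE] : exists2 k, k != 0 & q = k *: (s 1 *: u + t 1 *: v).
  have [k kn E] := vline_eqP q0 Pq; exists k^-1; first by rewrite invr_neq0.
  by rewrite E scalerA mulVf // scale1r.
pose D := s 0 * t 1 - s 1 * t 0.
(* If the determinant [D] of the coordinates of the two points vanished, independence of [p] and [q]
   would force [s 0 = t 0 = 0]. *)
have D0 : D != 0.
  apply/eqP => D0; move: (st 0); rewrite -negb_and; case/negP; apply/andP.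
  have [|_ /eqP] := pq (k1 * s 1) (- (k0 * s 0)).
    transitivity (- (k0 * k1 * D) *: v); last by rewrite D0 mulr0 oppr0 scale0r.
    by rewrite pE qE /D; apply/rowP => i; rewrite !mxE; ring.
  rewrite oppr_eq0 mulf_eq0 (negPf k0n) /= => ->.
  have [|_ /eqP] := pq (k1 * t 1) (- (k0 * t 0)).
    transitivity ((k0 * k1 * D) *: u); last by rewrite D0 mulr0 scale0r.
    by rewrite pE qE /D; apply/rowP => i; rewrite !mxE; ring.
  by rewrite oppr_eq0 mulf_eq0 (negPf k0n) /= => ->.
exists (- k0 ^+ 2 * k1 * D ^+ 2 * (t 2 * s 0 - s 2 * t 0)).
exists (- k0 * k1 ^+ 2 * D ^+ 2 * (t 2 * s 1 - s 2 * t 1)); split=> [x y|].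
  have -> : x *: p + y *: q =
      (x * k0 * s 0 + y * k1 * s 1) *: u + (x * k0 * t 0 + y * k1 * t 1) *: v.
    rewrite pE qE; apply/rowP => i; rewrite !mxE; ring.
  rewrite Fuv I3_prod /D; ring.
(* By Cramer's rule [B *: p - A *: q] is this nonzero multiple of [s 2 *: u + t 2 *: v]. *)
rewrite -(vlineZ _ (_ : k0 ^+ 2 * k1 ^+ 2 * D ^+ 3 != 0)); last by rewrite !mulf_neq0 ?expf_neq0.
congr (<[_]>)%VS; rewrite pE qE /D; apply/rowP => i; rewrite !mxE; ring.
Qed.

(** Two of the three linear forms vanish at [p], so both become multiples of [y] once [p] is
    completed by [w] to a basis of the line. *)
Lemma line_section_tangent p T : p != 0 -> line_section F <[p]> <[p]> T ->
  exists w A B, [/\ free [:: p; w],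
    (forall x y, F.@[(x *: p + y *: w) 0] = y ^+ 2 * (A * x + B * y)) &
    T = <[B *: p - A *: w]>%VS].
Proof.
move=> p0 [u [v [s [t [/free2P uv st [P0 P1 ->] Fuv]]]]].
have vlineE i : <[p]>%VS = <[s i *: u + t i *: v]>%VS ->
    exists2 k, k != 0 & p = k *: (s i *: u + t i *: v).
  move=> Pp; have [k kn E] := vline_eqP p0 Pp; exists k^-1; first by rewrite invr_neq0.
  by rewrite E scalerA mulVf // scale1r.
have [k0 k0n pE0] := vlineE _ P0; have [k1 k1n pE1] := vlineE _ P1.
have [st1 tt1] : k1 * s 1 = k0 * s 0 /\ k1 * t 1 = k0 * t 0.
  have [|/eqP + /eqP] := uv (k1 * s 1 - k0 * s 0) (k1 * t 1 - k0 * t 0).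
    transitivity (p - p); last by rewrite subrr.
    by rewrite {1}pE1 pE0; apply/rowP => i; rewrite !mxE; ring.
  by rewrite !subr_eq0 => /eqP -> /eqP ->.
have {}tt1 : t 1 = k1^-1 * (k0 * t 0) by rewrite -tt1 mulKf.
have {}st1 : s 1 = k1^-1 * (k0 * s 0) by rewrite -st1 mulKf.
(* Some coordinate of the point is nonzero, so one of [u] and [v] completes it to a basis. *)
have [al [be D0]] : exists al be, s 0 * be - t 0 * al != 0.
  case/orP: (st 0) => [s0|t0]; first by exists 0, 1; rewrite mulr1 mulr0 subr0.
  by exists 1, 0; rewrite mulr1 mulr0 sub0r oppr_eq0.
set D := _ - _ in D0.
exists (al *: u + be *: v), (k1^-1 * k0 ^+ 2 * D ^+ 2 * (t 2 * s 0 - s 2 * t 0)),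
  (k1^-1 * k0 * D ^+ 2 * (t 2 * al - s 2 * be)); split.
- apply/free2P => x y E.
  have [E1 E2] : x * k0 * s 0 + y * al = 0 /\ x * k0 * t 0 + y * be = 0.
    by apply: uv; rewrite -{}E pE0; apply/rowP => i; rewrite !mxE; ring.
  have Ex : x * k0 * D = 0.
    transitivity (be * (x * k0 * s 0 + y * al) - al * (x * k0 * t 0 + y * be)).
      by rewrite /D; ring.
    by rewrite E1 E2 !mulr0 subr0.
  have Ey : y * D = 0.
    transitivity (s 0 * (x * k0 * t 0 + y * be) - t 0 * (x * k0 * s 0 + y * al)).
      by rewrite /D; ring.
    by rewrite E1 E2 !mulr0 subr0.
  split; apply/eqP; first by move/eqP: Ex; rewrite !mulf_eq0 (negPf k0n) (negPf D0) !orbF.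
  by move/eqP: Ey; rewrite mulf_eq0 (negPf D0) orbF.
- move=> x y; have -> : x *: p + y *: (al *: u + be *: v) =
      (x * k0 * s 0 + y * al) *: u + (x * k0 * t 0 + y * be) *: v.
    by rewrite pE0; apply/rowP => i; rewrite !mxE; ring.
  by rewrite Fuv I3_prod st1 tt1 /D; ring.
rewrite -(vlineZ _ (_ : - (k1^-1 * k0 ^+ 2 * D ^+ 3) != 0)); last first.
  by rewrite oppr_eq0 !mulf_neq0 ?expf_neq0 ?invr_neq0.
congr (<[_]>)%VS; rewrite pE0 /D; apply/rowP => i; rewrite !mxE; ring.
Qed.

(** The third point has coordinates [(B, - A)], the root of [A * x + B * y]. It is unique because
    the values at [(1, 1)] and [(1, -1)] determine [A] and [B] when 2 is invertible. *)
Lemma third_secant p q A B : (2%:R : K) != 0 -> free [:: p; q] -> (A != 0) || (B != 0) ->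
  (forall x y, F.@[(x *: p + y *: q) 0] = x * y * (A * x + B * y)) ->
  third F <[p]> <[q]> = <[B *: p - A *: q]>%VS.
Proof.
move=> n2 pq AB FE; apply: xget_unique.
  exists p, q, (fun i => [tuple 1; 0; B]`_i), (fun i => [tuple 0; 1; - A]`_i); split => //=.
  - by move=> i; case: (I3P i) => ->; rewrite /= ?oner_eq0 ?orbT // oppr_eq0 orbC.
  - by rewrite !scale1r !scale0r addr0 add0r scaleNr.
  - by move=> x y; rewrite FE I3_prod /=; ring.
move=> T /(line_section_secant pq)[A' [B' [FE' ->]]].
have E1 := FE 1 1; rewrite FE' in E1.
have E2 := FE 1 (-1); rewrite FE' in E2.
have AA : A' = A.
  apply: (mulfI n2); transitivity (1 * 1 * (A' * 1 + B' * 1) - 1 * -1 * (A' * 1 + B' * -1)).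
    by ring.
  by rewrite E1 E2; ring.
have -> : B' = B.
  transitivity (1 * 1 * (A' * 1 + B' * 1) - A'); first by ring.
  by rewrite E1 AA; ring.
by rewrite AA.
Qed.

(** At a singular point every line through it has double contact, so the last hypothesis is what
    pins the tangent line down. *)
Lemma third_tangent p v A B : free [:: p; v] -> (A != 0) || (B != 0) ->
  (forall x y, F.@[(x *: p + y *: v) 0] = y ^+ 2 * (A * x + B * y)) ->
  (forall w A' B', (forall x y, F.@[(x *: p + y *: w) 0] = y ^+ 2 * (A' * x + B' * y)) ->
     exists al be, w = al *: p + be *: v) ->
  third F <[p]> <[p]> = <[B *: p - A *: v]>%VS.
Proof.
move=> pv AB FE tgt; apply: xget_unique.
  (* The representatives [1] and [-1] of the same point give the factors [- y] and [y], whose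
     product absorbs the sign of the third factor. *)
  exists p, v, (fun i => [tuple 1; -1; B]`_i), (fun i => [tuple 0; 0; - A]`_i); split => //=.
  - by move=> i; case: (I3P i) => ->; rewrite /= ?oppr_eq0 ?oner_eq0 // orbC.
  - rewrite !scale0r !addr0 scale1r vlineZ ?oppr_eq0 ?oner_eq0 //.
    by rewrite scaleNr.
  - by move=> x y; rewrite FE I3_prod /=; ring.
have p0 : p != 0.
  apply/eqP => p0; have /free2P/(_ 1 0)[|/eqP] := pv; last by rewrite oner_eq0.
  by rewrite p0 scaler0 scale0r addr0.
move=> T /(line_section_tangent p0)[w [A' [B' [/free2P pw FE' ->]]]].
have [al [be wE]] := tgt _ _ _ FE'.
have be0 : be != 0.
  apply/eqP => be0; have [|_ /eqP] := pw al (-1); last by rewrite oppr_eq0 oner_eq0.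
  by rewrite wE be0 scale0r addr0 scaleN1r subrr.
(* Passing from [v] to [w] substitutes [x + al * y] and [be * y] for the coordinates. Comparing
   coefficients shows that [B' *: p - A' *: w] is [be ^+ 3] times [B *: p - A *: v]. *)
have E x y : y ^+ 2 * (A' * x + B' * y) = (be * y) ^+ 2 * (A * (x + al * y) + B * (be * y)).
  rewrite -FE' -FE; suff -> : x *: p + y *: w = (x + al * y) *: p + (be * y) *: v by [].
  by rewrite wE; apply/rowP => i; rewrite !mxE; ring.
have BE : B' = be ^+ 2 * (A * al + B * be).
  transitivity (1 ^+ 2 * (A' * 0 + B' * 1)); first by ring.
  by rewrite E; ring.
have AE : A' = be ^+ 2 * A.
  transitivity (1 ^+ 2 * (A' * 1 + B' * 1) - B'); first by ring.
  by rewrite E BE; ring.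
rewrite -[RHS](vlineZ _ (_ : be ^+ 3 != 0)) ?expf_neq0 //; congr (<[_]>)%VS.
by rewrite AE BE wE; apply/rowP => i; rewrite !mxE; ring.
Qed.

End LineSections.

(** * Values and gradient of a Hesse cubic *)

Section Hesse.
Import mpoly.
Variable K : fieldType.
Implicit Types (a b c al be ga : K) (p q u v w : 'rV[K]_3).

Lemma tripleE al be ga :
  (triple al be ga 0 0 = al) * (triple al be ga 0 1 = be) * (triple al be ga 0 2 = ga).
Proof. by rewrite !mxE. Qed.

Lemma row3P u v : u 0 0 = v 0 0 -> u 0 1 = v 0 1 -> u 0 2 = v 0 2 -> u = v.
Proof. by move=> E0 E1 E2; apply/rowP => i; case: (I3P i) => ->. Qed.

Lemma triple_eq0 al be ga : (triple al be ga == 0) = [&& al == 0, be == 0 & ga == 0].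
Proof.
apply/eqP/and3P => [E0|[/eqP -> /eqP -> /eqP ->]]; last by apply: row3P; rewrite tripleE mxE.
have [[E1 E2] E3] := tripleE al be ga.
by split; [rewrite -E1|rewrite -E2|rewrite -E3]; rewrite E0 mxE.
Qed.

Lemma hesse_eval a b c v : (hesse_cubic a b c).@[v 0] =
  (a ^+ 3 + b ^+ 3 + c ^+ 3) * (v 0 0 * v 0 1 * v 0 2)
  - a * b * c * (v 0 0 ^+ 3 + v 0 1 ^+ 3 + v 0 2 ^+ 3).
Proof.
by rewrite /hesse_cubic !exprS !expr0 !(mevalB, mevalD, mevalZ, mevalM, meval1) !mevalXU.
Qed.

(** Homogeneity of degree 3 reduces the whole line of representatives to one vector. *)
Lemma on_curve_hesse a b c al be ga :
    triple al be ga != 0 -> (hesse_cubic a b c).@[triple al be ga 0] = 0 ->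
  on_curve (hesse_cubic a b c) (ppoint al be ga).
Proof.
move=> t0 Ft; split=> [|v /vlineP[k ->]]; first by rewrite dim_vline t0.
transitivity (k ^+ 3 * (hesse_cubic a b c).@[triple al be ga 0]); last by rewrite Ft mulr0.
by rewrite !hesse_eval !mxE; ring.
Qed.

Lemma meval_mderivXU (i j : 'I_3) v : (mderiv i ('X_j : {mpoly K[3]})).@[v 0] = (j == i)%:R.
Proof.
rewrite mderivX mevalZ mnm1E; case: eqP => [->|_]; last by rewrite mul0r.
by rewrite mul1r mevalX big1 // => k _; rewrite mnmBE subnn expr0.
Qed.

Lemma hesse_mderiv a b c i v : (mderiv i (hesse_cubic a b c)).@[v 0] =
  (a ^+ 3 + b ^+ 3 + c ^+ 3)
    * ((0 == i)%:R * v 0 1 * v 0 2 + v 0 0 * (1 == i)%:R * v 0 2 + v 0 0 * v 0 1 * (2 == i)%:R)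
  - 3%:R * (a * b * c)
    * ((0 == i)%:R * v 0 0 ^+ 2 + (1 == i)%:R * v 0 1 ^+ 2 + (2 == i)%:R * v 0 2 ^+ 2).
Proof.
rewrite /hesse_cubic !exprS !expr0 !mulr1 !(mderivB, mderivD, mderivZ, mderivM).
rewrite !(mevalB, mevalD, mevalZ, mevalM) !meval_mderivXU !mevalXU; ring.
Qed.

(** A column, so that [v *m hesse_grad a b c p] is the derivative at [p] along [v] and tangency is
    membership in a left kernel. *)
Definition hesse_grad a b c v : 'cV[K]_3 := \col_i (mderiv i (hesse_cubic a b c)).@[v 0].

Lemma hesse_grad_mul a b c p v : (v *m hesse_grad a b c p) 0 0 =
  (a ^+ 3 + b ^+ 3 + c ^+ 3)
    * (v 0 0 * p 0 1 * p 0 2 + p 0 0 * v 0 1 * p 0 2 + p 0 0 * p 0 1 * v 0 2)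
  - 3%:R * (a * b * c)
    * (v 0 0 * p 0 0 ^+ 2 + v 0 1 * p 0 1 ^+ 2 + v 0 2 * p 0 2 ^+ 2).
Proof.
rewrite mxE !big_ord_recl big_ord0 !mxE !hesse_mderiv.
have -> : lift ord0 ord0 = 1 :> 'I_3 by apply: val_inj.
have -> : lift ord0 (lift ord0 ord0) = 2 :> 'I_3 by apply: val_inj.
by rewrite /=; ring.
Qed.

End Hesse.

(** * Chords and tangents of a smooth Hesse cubic *)

Section SmoothHesse.
Import mpoly.
Variables (K : numFieldType) (a b c : K).
Local Notation E := (hesse_cubic a b c).
Local Notation S := (a ^+ 3 + b ^+ 3 + c ^+ 3).
Local Notation M := (a * b * c).
Implicit Types (al be ga : K) (p q u v w : 'rV[K]_3).

Hypothesis smE : smooth E.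

Lemma smooth_hesse_neq0 : M != 0.
Proof.
apply/eqP => m0.
have [||i] := smE (v := triple 1 0 0).
- by rewrite triple_eq0 oner_eq0.
- by rewrite hesse_eval !tripleE m0; ring.
case/eqP; rewrite hesse_mderiv !tripleE m0; ring.
Qed.

Lemma smooth_hesse_disc : S ^+ 3 - 27%:R * M ^+ 3 != 0.
Proof.
have m0 := smooth_hesse_neq0; apply/eqP => SM.
have S0 : S != 0.
  apply/eqP => S0; move/eqP: SM; rewrite S0 expr0n sub0r oppr_eq0 mulf_eq0 expf_eq0 (negPf m0) /=.
  by rewrite pnatr_eq0.
have [||i] := smE (v := triple (3%:R * M) S S).
- by rewrite triple_eq0 (negPf S0) !andbF.
- rewrite hesse_eval !tripleE; transitivity (M * (S ^+ 3 - 27%:R * M ^+ 3)); first by ring.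
  by rewrite SM mulr0.
(* The first partial derivative at this point is [S^3 - 27 M^3]; the other two vanish
   identically. *)
by case/eqP; rewrite hesse_mderiv !tripleE; case: (I3P i) => -> /=; [rewrite -[RHS]SM|..]; ring.
Qed.

Lemma third_hesse_tangent p v A B : free [:: p; v] -> (A != 0) || (B != 0) ->
  (forall x y, E.@[(x *: p + y *: v) 0] = y ^+ 2 * (A * x + B * y)) ->
  third E <[p]> <[p]> = <[B *: p - A *: v]>%VS.
Proof.
(* The gradient at p kills every tangent direction, so these lie in its kernel,
   a plane containing p by Euler's identity. *)
have tgt w A' B' : (forall x y, E.@[(x *: p + y *: w) 0] = y ^+ 2 * (A' * x + B' * y)) ->
    w *m hesse_grad a b c p = 0.
  move=> FE; have n2 : (2%:R : K) != 0 by rewrite pnatr_eq0.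
  apply/rowP => j; rewrite (ord1 j) [RHS]mxE; apply: (mulfI n2); rewrite mulr0 hesse_grad_mul.
  (* In the expansion of the cubic at [p], the terms even in [w] cancel and the last summand removes
     the cubic term, leaving twice the derivative at [p] along [w]. *)
  transitivity (E.@[(1 *: p + 1 *: w) 0] - E.@[(1 *: p + -1 *: w) 0]
      - 2%:R * E.@[(0 *: p + 1 *: w) 0]).
    by rewrite !hesse_eval !mxE; ring.
  by rewrite !FE; ring.
move=> pv AB FE; apply: (third_tangent pv AB FE) => w A' B' FE'.
have p0 : p != 0.
  apply/eqP => p0; have /free2P/(_ 1 0)[|/eqP] := pv; last by rewrite oner_eq0.
  by rewrite p0 scaler0 scale0r addr0.
have Fp : E.@[p 0] = 0.
  by have := FE 1 0; rewrite scale1r scale0r addr0 => ->; ring.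
apply: (kernel_plane pv _ _ (tgt _ _ _ FE) (tgt _ _ _ FE')).
  by have [i gi] := smE p0 Fp; move: gi; apply: contraNneq => /colP/(_ i); rewrite !mxE => ->.
apply/rowP => j; rewrite (ord1 j) [RHS]mxE hesse_grad_mul.
by transitivity (3%:R * E.@[p 0]); [rewrite hesse_eval; ring|rewrite Fp mulr0].
Qed.

(** The origin is a flex: on its tangent line, spanned with [(- S, 0, 3M)], the cubic is a constant
    times [y ^+ 3], so [A = 0] and the third point is the origin again. *)
Lemma third_hesse_origin : third E (hesse_origin K) (hesse_origin K) = hesse_origin K.
Proof.
have m0 := smooth_hesse_neq0; have d0 := smooth_hesse_disc.
have m3 : 3%:R * M != 0 by rewrite mulf_neq0 ?pnatr_eq0.
rewrite /hesse_origin /ppoint.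
rewrite (@third_hesse_tangent _ (triple (- S) 0 (3%:R * M)) 0 (M * (S ^+ 3 - 27%:R * M ^+ 3))).
- by rewrite scale0r subr0; apply: vlineZ; apply: mulf_neq0.
- apply/free2P => x y /rowP E0.
  have := E0 2; rewrite !mxE /= mulr0 add0r => /eqP; rewrite mulf_eq0 (negPf m3) orbF => /eqP y0.
  by have := E0 1; rewrite !mxE /= y0 mul0r addr0 mulrN1 => /eqP; rewrite oppr_eq0 => /eqP.
- by rewrite mulf_neq0 ?orbT.
- by move=> x y; rewrite hesse_eval !mxE /=; ring.
Qed.

(** With [q = (al, be, ga)] and [O = (1, -1, 0)], the vector [(be, al, ga)] is [q + (be - al) O], so
    it lies on the chord. When [q] represents the origin, the chord becomes the flex tangent. *)
Lemma third_hesse_opp al be ga : triple al be ga != 0 -> E.@[triple al be ga 0] = 0 ->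
  third E (ppoint al be ga) (hesse_origin K) = ppoint be al ga.
Proof.
have m0 := smooth_hesse_neq0; have d0 := smooth_hesse_disc.
move=> q0; rewrite hesse_eval !tripleE => Fq.
have [/andP[/eqP ga0 /eqP albe]|gaO] := boolP ((ga == 0) && (al + be == 0)).
  have {}albe : be = - al by apply/eqP; rewrite -addr_eq0 addrC albe.
  have al0 : al != 0 by move: q0; rewrite triple_eq0 albe ga0 eqxx oppr_eq0 andbT andbb.
  have qO k : k != 0 -> ppoint k (- k) 0 = hesse_origin K.
    move=> k0; rewrite /hesse_origin /ppoint -[RHS](vlineZ _ k0); congr (<[_]>)%VS.
    by apply: row3P; rewrite !mxE /=; ring.
  by rewrite albe ga0 qO // -{2}[al]opprK qO ?oppr_eq0 // third_hesse_origin.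
(* Up to sign, [k] is the derivative of the cubic at the origin along [(al, be, ga)]. It vanishes
   only on the flex tangent, which meets the curve at the origin alone. *)
pose k := S * ga + 3%:R * M * (al + be).
have k0 : k != 0.
  apply: contra gaO => /eqP k0.
  (* The sum of cubes [(S ga)^3 + (3M (al + be))^3], divisible by [k], is reduced modulo the
     equation of the curve. So [k = 0] forces [ga = 0], and then [al + be = 0]. *)
  have E1 : (S ^+ 3 - 27%:R * M ^+ 3) * ga ^+ 3 = 0.
    transitivity (k * ((S * ga) ^+ 2 - S * ga * (3%:R * M * (al + be))
        + (3%:R * M * (al + be)) ^+ 2)
      - 27%:R * M ^+ 2 * al * be * k
      + 27%:R * M ^+ 2 * (S * (al * be * ga) - M * (al ^+ 3 + be ^+ 3 + ga ^+ 3))).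
      by rewrite /k; ring.
    by rewrite k0 Fq !mulr0 mul0r addr0 subr0.
  move/eqP: E1; rewrite mulf_eq0 (negPf d0) expf_eq0 /= => /eqP ga0.
  by move/eqP: k0; rewrite /k ga0 mulr0 add0r eqxx mulf_eq0 (mulf_eq0 3%:R) pnatr_eq0 (negPf m0).
rewrite /hesse_origin /ppoint (@third_secant _ _ _ _ ((be - al) * k) (- k)).
- rewrite -[RHS](vlineZ _ (_ : - k != 0)) ?oppr_eq0 //; congr (<[_]>)%VS.
  by apply: row3P; rewrite !mxE /=; ring.
- by rewrite pnatr_eq0.
- apply/free2P => x y /rowP E0.
  have E00 := E0 0; have E01 := E0 1; have := E0 2.
  rewrite !mxE /= in E00 E01 *; rewrite mulr0 addr0 => Ega.
  have Ex : x * (al + be) = 0.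
    by transitivity (x * al + y * 1 + (x * be + y * -1)); [ring|rewrite E00 E01 addr0].
  have x0 : x = 0.
    apply/eqP; apply: contraNT gaO => x0.
    move/eqP: Ex; rewrite mulf_eq0 (negPf x0) /= => ->; rewrite andbT.
    by rewrite -[ga == 0]/(false || _) -(negPf x0) -mulf_eq0 Ega.
  by split => //; rewrite -E00 x0; ring.
- by rewrite oppr_eq0 k0 orbT.
- move=> x y; rewrite hesse_eval !mxE /=.
  transitivity (x ^+ 3 * (S * (al * be * ga) - M * (al ^+ 3 + be ^+ 3 + ga ^+ 3))
      + x * y * ((be - al) * k * x + - k * y)).
    by rewrite /k; ring.
  by rewrite Fq mulr0 add0r.
Qed.

(** As [a], [b], [c] are nonzero, vanishing of the triple would make their cubes equal and give
    [S^3 = 27 M^3]. *)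
Lemma hesse_tangent_neq0 :
  triple (a * (b ^+ 3 - c ^+ 3)) (b * (c ^+ 3 - a ^+ 3)) (c * (a ^+ 3 - b ^+ 3)) != 0.
Proof.
have m0 := smooth_hesse_neq0; rewrite triple_eq0; apply: contraNN smooth_hesse_disc.
move: m0; rewrite !mulf_eq0 !negb_or => /andP[/andP[a0 b0] c0].
rewrite (negPf a0) (negPf b0) !subr_eq0 /= => /and3P[/eqP bc /eqP ca _].
by rewrite !exprMn bc ca; apply/eqP; ring.
Qed.

Lemma third_hesse_double :
  third E (ppoint a b c) (ppoint a b c) =
    ppoint (a * (b ^+ 3 - c ^+ 3)) (b * (c ^+ 3 - a ^+ 3)) (c * (a ^+ 3 - b ^+ 3)).
Proof.
have m0 := smooth_hesse_neq0; have t0 := hesse_tangent_neq0.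
set t := triple (a * (b ^+ 3 - c ^+ 3)) _ _ in t0.
pose A := - (M * (S ^+ 3 - 27%:R * M ^+ 3)).
have A0 : A != 0 by rewrite oppr_eq0 mulf_neq0 ?smooth_hesse_disc.
have FE x y : E.@[(x *: triple a b c + y *: t) 0] = y ^+ 2 * (A * x + 0 * y).
  by rewrite hesse_eval !mxE /= /A; ring.
rewrite /ppoint -/t (third_hesse_tangent _ _ FE) ?A0 //.
  by rewrite scale0r sub0r -scaleNr; apply: vlineZ; rewrite oppr_eq0.
(* Independence is read off the cubic: a relation between the two vectors gives [A x y^2 = 0], so
   one coefficient vanishes, and then the other since both vectors are nonzero. *)
apply/free2P => x y E0; have := FE x y.
have -> : E.@[(x *: triple a b c + y *: t) 0] = 0 by rewrite E0 hesse_eval !mxE; ring.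
rewrite mul0r addr0 => /esym/eqP; rewrite mulf_eq0 expf_eq0 (mulf_eq0 A) (negPf A0) /=.
case/orP => /eqP z0; move: E0; rewrite z0 scale0r ?addr0 ?add0r => /eqP; rewrite scaler_eq0.
  rewrite triple_eq0 => /orP[/eqP //|/and3P[/eqP a0]].
  by rewrite a0 !mul0r eqxx in m0.
by rewrite (negPf t0) orbF => /eqP.
Qed.

Lemma ecmul_hesse_neg2 :
  ecmul E (hesse_origin K) (-2) (ppoint a b c) =
    ppoint (a * (b ^+ 3 - c ^+ 3)) (b * (c ^+ 3 - a ^+ 3)) (c * (a ^+ 3 - b ^+ 3)).
Proof.
have m0 := smooth_hesse_neq0.
have tr_neq0 x y z : M = x * y * z -> triple x y z != 0.
  move=> Mxyz; apply: contraNN m0; rewrite triple_eq0 Mxyz => /and3P[/eqP -> _ _].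
  by rewrite !mul0r.
have pO : third E (ppoint a b c) (hesse_origin K) = ppoint b a c.
  by apply: third_hesse_opp; rewrite ?tr_neq0 // hesse_eval !tripleE; ring.
have nO : third E (ppoint b a c) (hesse_origin K) = ppoint a b c.
  by apply: third_hesse_opp; rewrite ?tr_neq0 ?hesse_eval ?tripleE //; ring.
have t0 := hesse_tangent_neq0.
(* [Negz 1] is -2: two additions of [p] to the origin, then an opposite. The first addition returns
   [p], the second swaps the first two coordinates of the tangent point, and the opposite swaps them
   back. *)
rewrite -[(-2)%R]/(Negz 1) /ecmul /ecopp /= /ecadd pO nO third_hesse_double third_hesse_origin.
set x := a * _ in t0 *; set y := b * _ in t0 *; set z := c * _ in t0 *.
have Ft : E.@[triple x y z 0] = 0 by rewrite hesse_eval !tripleE /x /y /z; ring.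
rewrite third_hesse_opp // third_hesse_opp //.
  by move: t0; rewrite !triple_eq0 andbCA.
by rewrite -[RHS]Ft !hesse_eval !tripleE; ring.
Qed.

End SmoothHesse.

(** * Potentials and relations in abstract modules and algebras *)

(** Models a cyclic derivative [D]: the three rotations of a mixed word have the same image, and
    only one of the cubes contributes, so a common factor 3 comes out. *)
Lemma linear_potential (K : fieldType) (V W : lmodType K) (D : {linear V -> W}) (al be ga : K)
    (xyz yzx zxy yxz xzy zyx xxx yyy zzz : V) (yz zy xx : W) :
    D xyz = yz -> D yzx = yz -> D zxy = yz ->
    D yxz = zy -> D xzy = zy -> D zyx = zy ->
    D xxx = 3%:R *: xx -> D yyy = 0 -> D zzz = 0 ->
  D (al *: (xyz + yzx + zxy) + be *: (yxz + xzy + zyx) + ga *: (xxx + yyy + zzz))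
    = 3%:R *: (al *: yz + be *: zy + ga *: xx).
Proof.
move=> E1 E2 E3 E4 E5 E6 E7 E8 E9.
have DD u v : D (u + v) = D u + D v by exact: linearD.
have DZ k u : D (k *: u) = k *: D u by exact: linearZ.
rewrite !(DD, DZ) E1 E2 E3 E4 E5 E6 E7 E8 E9 !addr0.
have T u : u + u + u = 3%:R *: u by rewrite -mulr2n -mulrSr scaler_nat.
by rewrite !T !scalerDr !scalerA ![_ * 3%:R]mulrC.
Qed.

(* Over an abstract algebra, since comparing products of concrete generators
   unfolds the product of the free algebra and does not terminate in practice. *)
Section AlgebraIdentities.
Variables (K : fieldType) (A : algType K).
Implicit Types (a b c : K) (x y z : A).

Definition skl_rel a b c x y z : A := a *: (x * y) + b *: (y * x) + c *: z ^+ 2.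

Definition skl_pot a b c x y z : A :=
  a *: (x * y * z + y * z * x + z * x * y) + b *: (y * x * z + x * z * y + z * y * x)
  + c *: (x ^+ 3 + y ^+ 3 + z ^+ 3).

(** Lets every cyclic derivative of the potential be taken in its first variable. *)
Lemma skl_pot_rot a b c x y z : skl_pot a b c x y z = skl_pot a b c y z x.
Proof.
rewrite /skl_pot; congr (_ *: _ + _ *: _ + _ *: _).
- by rewrite -addrA addrC.
- by rewrite addrC addrA.
- by rewrite -addrA addrC.
Qed.

Lemma skl_potZ (k : K) a b c x y z :
  skl_pot (k * a) (k * b) (k * c) x y z = k *: skl_pot a b c x y z.
Proof. by rewrite /skl_pot !scalerDr !scalerA. Qed.

(* Applying a linear form phi makes the identity a commutative one. *)
Lemma linear_c3_sub_Psi (phi : {scalar A}) a b c x y z : phi (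
  ((c * (a ^+ 3 - c ^+ 3)) *: x ^+ 3
  + (a * (b ^+ 3 - c ^+ 3)) *: (x * y * z)
  + (b * (c ^+ 3 - a ^+ 3)) *: (y * x * z)
  + (c * (c ^+ 3 - b ^+ 3)) *: y ^+ 3) *+ 3 -
  skl_pot (a * (b ^+ 3 - c ^+ 3)) (b * (c ^+ 3 - a ^+ 3)) (c * (a ^+ 3 - b ^+ 3)) x y z)
  = phi (
    (b ^+ 3 - a ^+ 3) *: (skl_rel a b c x y z * z)
  + (a ^+ 3 + b ^+ 3 - c ^+ 3 *+ 2) *: (x * skl_rel a b c y z x)
  + (a ^+ 3 - c ^+ 3) *: (skl_rel a b c y z x * x)
  + (c ^+ 3 *+ 2 - a ^+ 3 - b ^+ 3) *: (y * skl_rel a b c z x y)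
  + (c ^+ 3 - b ^+ 3) *: (skl_rel a b c z x y * y)).
Proof.
rewrite /skl_pot /skl_rel !exprS !expr0 !mulr1 !mulrDl !mulrDr -!(scalerAl, scalerAr) !mulrA.
have DD u v : phi (u + v) = phi u + phi v by exact: linearD.
have DN u : phi (- u) = - phi u by exact: linearN.
have DM u n : phi (u *+ n) = phi u *+ n by exact: linearMn.
have DZ k u : phi (k *: u) = k * phi u by exact: linearZ.
by rewrite !(DD, DZ, DM, DN); ring.
Qed.

End AlgebraIdentities.

(** * Cyclic derivatives and superpotentials in the free algebra *)

Section FreeAlgebraPotentials.
Import finmap monalg.
Variable K : fieldType.
Implicit Types w : seq 'I_3.

Lemma wordM w1 w2 : word K w1 * word K w2 = word K (w1 ++ w2).
Proof. 
by rewrite /word [LHS]malgM_def fgmulUU mulr1 -[FMonom (w1 ++ w2)](fmmulE (FMonom w1) (FMonom w2)).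
Qed.

(** The defining sums run over different supports; all are extended to one union of supports, where
    the added coefficients are zero. *)
Lemma cyc_deriv_is_linear v : linear (@cyc_deriv K v).
Proof.
have E d (f : free_alg K) : (msupp f `<=` d)%fset ->
    cyc_deriv v f = \sum_(m <- d) (f : {malg K[{fmonom 'I_3}]})@_m *: cyc_deriv_word K v m.
  move=> le_d; rewrite /cyc_deriv (big_fset_incl _ le_d) // => m _ /mcoeff_outdom ->.
  by rewrite scale0r.
move=> k f g; rewrite (E (msupp f `|` msupp g)%fset); last first.
  apply: fsubset_trans (msuppD_le _ _) _.
  by apply: fsetSU; apply: msuppZ_le.
rewrite (E _ _ (fsubsetUl (msupp f) (msupp g))) (E _ _ (fsubsetUr (msupp f) (msupp g))).
rewrite scaler_sumr -big_split /=; apply: eq_bigr => m _.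
by rewrite mcoeffD mcoeffZ scalerDl scalerA.
Qed.

HB.instance Definition _ v :=
  GRing.isLinear.Build K (free_alg K) (free_alg K) *:%R (@cyc_deriv K v)
    (cyc_deriv_is_linear v).

Lemma cyc_derivU v w : cyc_deriv v (word K w) = cyc_deriv_word K v w.
Proof.
by rewrite /cyc_deriv msuppU oner_eq0 big_seq_fset1 mcoeffUU scale1r.
Qed.

Local Notation x := (gen K 0).
Local Notation y := (gen K 1).
Local Notation z := (gen K 2).

Lemma gen2 i j : gen K i * gen K j = word K [:: i; j].
Proof. exact: wordM. Qed.

Lemma gen3 i j k : gen K i * gen K j * gen K k = word K [:: i; j; k].
Proof. by rewrite gen2; exact: wordM. Qed.

Lemma cyc_deriv_word3 v i j k : cyc_deriv_word K v [:: i; j; k] =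
  (i == v)%:R *: word K [:: j; k] + (j == v)%:R *: word K [:: k; i]
  + (k == v)%:R *: word K [:: i; j].
Proof.
have E (V : lmodType K) (P : pred nat) (F : nat -> V) : \sum_(n < 3 | P n) F n =
    (P 0)%:R *: F 0 + (P 1)%:R *: F 1 + (P 2)%:R *: F 2.
  rewrite big_mkcond !big_ord_recl big_ord0 /= addr0 addrA.
  by rewrite /bump /=; case: (P 0); case: (P 1); case: (P 2); rewrite ?scale1r ?scale0r.
exact: (E _ (fun n => nth ord0 [:: i; j; k] n == v)
  (fun n => word K (drop n.+1 [:: i; j; k] ++ take n [:: i; j; k]))).
Qed.

Lemma cyc_deriv_gen3 v i j k : cyc_deriv v (gen K i * gen K j * gen K k) =
  (i == v)%:R *: (gen K j * gen K k) + (j == v)%:R *: (gen K k * gen K i)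
  + (k == v)%:R *: (gen K i * gen K j).
Proof. by rewrite gen3 cyc_derivU cyc_deriv_word3 -!gen2. Qed.

Lemma cyc_deriv_genX3 v i :
  cyc_deriv v (gen K i ^+ 3) = (i == v)%:R *: (3%:R *: gen K i ^+ 2).
Proof.
have X3 (V : algType K) (f : V) : f ^+ 3 = f * f * f by rewrite exprSr expr2.
have X2 (V : algType K) (k : K) (f : V) :
    k *: (f * f) + k *: (f * f) + k *: (f * f) = k *: (3%:R *: f ^+ 2).
  by rewrite expr2 -!scalerDr -mulr2n -mulrSr scaler_nat.
by rewrite [X in cyc_deriv v X]X3 cyc_deriv_gen3; exact: X2.
Qed.

(** Since the indices are distinct, [i] occurs once in each mixed word, and deleting it cyclically
    leaves the same two letters for all three rotations. *)
Lemma cyc_deriv_skl_pot al be ga i j k : uniq [:: i; j; k] ->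
  cyc_deriv i (skl_pot al be ga (gen K i) (gen K j) (gen K k)) =
    3%:R *: skl_rel al be ga (gen K j) (gen K k) (gen K i).
Proof.
rewrite /= !inE andbT negb_or => /andP[/andP[ij ik] _].
have [ji ki] : (j == i) = false /\ (k == i) = false.
  by rewrite eq_sym (negPf ij) eq_sym (negPf ik).
have sel1 (V : lmodType K) (f g h : V) : true%:R *: f + false%:R *: g + false%:R *: h = f.
  by rewrite !scale0r scale1r !addr0.
have sel2 (V : lmodType K) (f g h : V) : false%:R *: f + true%:R *: g + false%:R *: h = g.
  by rewrite !scale0r scale1r addr0 add0r.
have sel3 (V : lmodType K) (f g h : V) : false%:R *: f + false%:R *: g + true%:R *: h = h.
  by rewrite !scale0r scale1r !add0r.
apply: linear_potential.
1-6: rewrite [LHS]cyc_deriv_gen3 eqxx ji ki.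
7-9: rewrite [LHS]cyc_deriv_genX3 ?eqxx ?ji ?ki.
- exact: sel1.
- exact: sel3.
- exact: sel2.
- exact: sel2.
- exact: sel1.
- exact: sel3.
- exact: scale1r.
- exact: scale0r.
- exact: scale0r.
Qed.

Local Notation coef m := (@mcoeff {fmonom 'I_3} K m : free_alg K -> K).

Lemma coef_is_linear (m : {fmonom 'I_3}) : scalar (coef m).
Proof. by move=> k f g; rewrite /= mcoeffD mcoeffZ. Qed.

HB.instance Definition _ (m : {fmonom 'I_3}) :=
  GRing.isLinear.Build K (free_alg K) K *%R (coef m) (coef_is_linear m).

(** An explicit certificate of membership in the ideal of relations: each summand is a relation
    times one variable, up to a scalar. It is checked on coefficients, which are linear forms
    separating elements. *)
Lemma c3_sub_Psi a b c :
  c3 a b c *+ 3 - Psi a b c =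
    (b ^+ 3 - a ^+ 3) *: (skl_rel a b c x y z * z)
  + (a ^+ 3 + b ^+ 3 - c ^+ 3 *+ 2) *: (x * skl_rel a b c y z x)
  + (a ^+ 3 - c ^+ 3) *: (skl_rel a b c y z x * x)
  + (c ^+ 3 *+ 2 - a ^+ 3 - b ^+ 3) *: (y * skl_rel a b c z x y)
  + (c ^+ 3 - b ^+ 3) *: (skl_rel a b c z x y * y).
Proof.
apply/malgP => m.
exact: (linear_c3_sub_Psi (coef m : {scalar free_alg K})).
Qed.

Lemma sub_ideal_gen (A : algType K) (S : set A) x : S x -> ideal_gen S x.
Proof. exact: sub_gen_smallest. Qed.

Lemma ideal_gen_subset (A : algType K) (S T : set A) :
  (forall x, S x -> ideal_gen T x) -> (ideal_gen S `<=` ideal_gen T)%classic.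
Proof. by move=> ST; apply: smallest_sub => //; exact: ideal_gen_ideal. Qed.

(** Ideals are defined by ring products only; the scalar [k] acts as multiplication by [k *: 1]. *)
Lemma ideal_genZ (A : algType K) (S : set A) k x : ideal_gen S x -> ideal_gen S (k *: x).
Proof.
have [_ _ IM] := ideal_gen_ideal S.
by move=> Sx; rewrite -[x]mul1r scalerAl -[_ * x]mulr1; exact: IM.
Qed.

Lemma sklyanin_relationsP (al be ga : K) (f : free_alg K) :
  sklyanin_relations al be ga f <->
  [\/ f = skl_rel al be ga x y z, f = skl_rel al be ga y z x | f = skl_rel al be ga z x y].
Proof.
rewrite /sklyanin_relations /= !inE; split.
- by case/or3P => /eqP ->; [constructor 1|constructor 2|constructor 3].
- by case=> ->; apply/or3P; [constructor 1|constructor 2|constructor 3]; apply/eqP.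
Qed.

Lemma cyc_deriv_sklyanin_potential al be ga :
  [/\ cyc_deriv 0 (sklyanin_potential al be ga) = 3%:R *: skl_rel al be ga y z x,
      cyc_deriv 1 (sklyanin_potential al be ga) = 3%:R *: skl_rel al be ga z x y &
      cyc_deriv 2 (sklyanin_potential al be ga) = 3%:R *: skl_rel al be ga x y z].
Proof.
have E : sklyanin_potential al be ga = skl_pot al be ga x y z by [].
split; rewrite E; first exact: cyc_deriv_skl_pot.
- by rewrite skl_pot_rot; exact: cyc_deriv_skl_pot.
- by rewrite 2!skl_pot_rot; exact: cyc_deriv_skl_pot.
Qed.

Lemma superpotentialZ (k : K) (W : free_alg K) (S : set (free_alg K)) :
  k != 0 -> superpotential W S -> superpotential (k *: W) S.
Proof.
move=> k0; rewrite /superpotential => <-; apply/seteqP; split; apply: ideal_gen_subset => _ [v ->].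
- have -> : cyc_deriv v (k *: W) = k *: cyc_deriv v W by exact: linearZ.
  by apply: ideal_genZ; apply: sub_ideal_gen; exists v.
- have <- : k^-1 *: cyc_deriv v (k *: W) = cyc_deriv v W.
    have -> : cyc_deriv v (k *: W) = k *: cyc_deriv v W by exact: linearZ.
    by rewrite scalerA mulVf ?scale1r.
  by apply: ideal_genZ; apply: sub_ideal_gen; exists v.
Qed.

(** The cyclic derivatives are 3 times the relations, in rotated order; the inverse of 3 gives the
    reverse inclusion of ideals. *)
Lemma superpotential_sklyanin (al be ga : K) : (3%:R : K) != 0 ->
  superpotential (sklyanin_potential al be ga) (sklyanin_relations al be ga).
Proof.
move=> n3; have [D0 D1 D2] := cyc_deriv_sklyanin_potential al be ga.
apply/seteqP; split; apply: ideal_gen_subset => f.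
- case=> v ->; case: (I3P v) => ->; rewrite ?D0 ?D1 ?D2; apply: ideal_genZ;
    apply: sub_ideal_gen; apply/sklyanin_relationsP.
  + by constructor 2.
  + by constructor 3.
  + by constructor 1.
- have inv3 (V : lmodType K) (u w : V) : u = 3%:R *: w -> w = 3%:R^-1 *: u.
    by move=> ->; rewrite scalerA mulVf ?scale1r.
  case/sklyanin_relationsP => ->;
    [rewrite (inv3 _ _ _ D2)|rewrite (inv3 _ _ _ D0)|rewrite (inv3 _ _ _ D1)];
    apply: ideal_genZ; apply: sub_ideal_gen.
  + by exists 2.
  + by exists 0.
  + by exists 1.
Qed.

Lemma pi_c3_Psi (a b c : K) :
  \pi_(sklyanin a b c) (c3 a b c) *+ 3 = \pi_(sklyanin a b c) (Psi a b c).
Proof.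
pose S := sklyanin_relations a b c.
have piMn (f : free_alg K) : \pi_(quot_alg S) f *+ 3 = \pi_(quot_alg S) (f *+ 3).
  by rewrite !mulrSr !mulr0n !add0r !quot_piD.
apply: etrans (piMn _) _; apply/pi_quotP/ideal_predP.
rewrite c3_sub_Psi.
have [_ ID IM] := ideal_gen_ideal S.
have Ml f g : ideal_gen S f -> ideal_gen S (g * f).
  by move=> Sf; rewrite -[_ * _]mulr1; exact: IM.
have Mr f g : ideal_gen S f -> ideal_gen S (f * g).
  by move=> Sf; rewrite -[f]mul1r; exact: IM.
have Sr f :
    [\/ f = skl_rel a b c x y z, f = skl_rel a b c y z x | f = skl_rel a b c z x y] ->
    ideal_gen S f.
  by move=> Sf; apply: sub_ideal_gen; apply/sklyanin_relationsP.
have S1 : ideal_gen S (skl_rel a b c x y z) by apply: Sr; constructor 1.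
have S2 : ideal_gen S (skl_rel a b c y z x) by apply: Sr; constructor 2.
have S3 : ideal_gen S (skl_rel a b c z x y) by apply: Sr; constructor 3.
refine (ID _ _ (ID _ _ (ID _ _ (ID _ _ _ _) _) _) _); apply: ideal_genZ.
- exact: Mr.
- exact: Ml.
- exact: Mr.
- exact: Ml.
- exact: Mr.
Qed.

End FreeAlgebraPotentials.

Theorem theorem1 (R : realType) (a b c : R[i]) :
  let E := hesse_cubic a b c in
  let p := ppoint a b c in
  let A := sklyanin a b c in
  smooth E -> on_curve E p ->
  \pi_A (c3 a b c) *+ 3 = \pi_A (Psi a b c) /\
  let q := ecmul E (hesse_origin R[i]) (-2) p in
  on_curve E q /\
  forall al be ga : R[i], ppoint al be ga = q ->
    superpotential (Psi a b c) (sklyanin_relations al be ga) /\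
    exists2 k : R[i], k != 0 & Psi a b c = k *: sklyanin_potential al be ga.
Proof.
move=> E p A smE _; split; first exact: pi_c3_Psi.
move=> q; have t0 := hesse_tangent_neq0 smE.
have qE : q = ppoint (a * (b ^+ 3 - c ^+ 3)) (b * (c ^+ 3 - a ^+ 3)) (c * (a ^+ 3 - b ^+ 3)).
  exact: ecmul_hesse_neg2.
split; first by rewrite qE; apply: on_curve_hesse; rewrite // hesse_eval !tripleE; ring.
move=> al be ga; rewrite qE => /esym/(vline_eqP t0)[l l0 lE].
(* The triple [(al, be, ga)] is [l] times the parameters of [Psi], and the potential is linear in
   its parameters. *)
have PsiE : Psi a b c = l^-1 *: sklyanin_potential al be ga.
  have tE : triple (a * (b ^+ 3 - c ^+ 3)) (b * (c ^+ 3 - a ^+ 3)) (c * (a ^+ 3 - b ^+ 3))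
      = triple (l^-1 * al) (l^-1 * be) (l^-1 * ga).
    transitivity (l^-1 *: triple al be ga); first by rewrite lE scalerA mulVf // scale1r.
    by apply: row3P; rewrite !mxE.
  have [e1 e2 e3] : [/\ a * (b ^+ 3 - c ^+ 3) = l^-1 * al,
      b * (c ^+ 3 - a ^+ 3) = l^-1 * be & c * (a ^+ 3 - b ^+ 3) = l^-1 * ga].
    have /matrixP/(_ 0) tE0 := tE.
    by split; [have := tE0 0|have := tE0 1|have := tE0 2]; rewrite !tripleE.
  have := skl_potZ l^-1 al be ga (gen R[i] 0) (gen R[i] 1) (gen R[i] 2).
  by rewrite -e1 -e2 -e3.
split; last by exists l^-1; rewrite ?invr_neq0.
rewrite PsiE; apply: superpotentialZ; first by rewrite invr_neq0.
by apply: superpotential_sklyanin; rewrite pnatr_eq0.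
Qed.
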